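(* Let $f,g\in(3')$ be as in the context, with $\bar f\neq\bar g$. Let $0\le i<l\le k$ and suppose $$\bar f=u_0\cdots u_{i-1}\,(m-3)(s_i,s'_i)\,\bar g\,(m-2)(s'_{l+1},s_{l+1})\,u_{l+2}\cdots u_{k+1}y_{k+1},$$ where $m_{s_is'_i}\ge3$, the word preceding $\bar g$ is non-empty, and $|u_{l+1}|>1$. Let $(f,g)_{\bar f}$ be the inclusion composition for this occurrence of $\bar g$. Then one of the following holds: (i) $|v_0|=|v_1|=1$ and: if $i=0$, then $(f,g)_{\bar f}\equiv0$; if $i>0$, then $$(f,g)_{\bar f}\equiv u_0\cdots u_{i-1}s_is_j\,(m-2)(s'_i,s_i)\,s_{i+1}\cdots s_l\,u_{l+2}\cdots u_{k+1}y_{k+1}-s'_0u_0\cdots u_{k+1},$$ where $s_j$ $(i+1\le j\le l+1)$ is the letter with $s_j=p'_0$; (ii) $|v_0|=1$, $|v_1|=2$, $|v_n|=1$ for all $n$ with $1<n\le q+1$, and $$(f,g)_{\bar f}\equiv u_0\cdots u_{i-1}(m-3)(s_i,s'_i)s_{i+1}s'_{i+1}x_is_{i+1}\cdots s_l\,(m-2)(s'_{i+1},x_i)\,u_{l+2}\cdots u_{k+1}y_{k+1}-s'_0u_0\cdots u_{k+1}.$$ Here $\equiv$ is congruence modulo $(S,\bar f)$.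
   Context: Coxeter setting. $\Sigma=\{\sigma_1,\dots,\sigma_n\}$ is finite, $(m_{ij})$ is a Coxeter matrix (symmetric, $m_{ii}=1$, $2\le m_{ij}\le\infty$ for $i\neq j$); for $s=\sigma_i,s'=\sigma_j$ write $m_{ss'}=m_{ij}$. $\Sigma^*$ is the free monoid (empty word $1$) with the deg-lex ordering (length first, then lexicographic with $\sigma_1<\dots<\sigma_n$); $|u|$ is word length; $\bar f$ is the largest word of $f\in F\langle\Sigma\rangle$, $F$ a field. For finite $m_{ss'}$, $m(s,s')$ is the alternating word $ss's\cdots$ of length $m_{ss'}$ and $(m-t)(s,s')$ the alternating word $ss's\cdots$ of length $m_{ss'}-t$ ($m$ refers to the pair in parentheses). $S$ is the union of: $(1)$ all $s^2-1$, $s\in\Sigma$; $(2)$ all $m(s,s')-m(s',s)$, $s>s'$, $m_{ss'}<\infty$; $(3')$ all $(m-1)(s_0,s_0')\cdots(m-1)(s_k,s_k')m(s_{k+1},s'_{k+1})-m(s'_0,s_0)(m-1)(s_1,s_1')\cdots(m-1)(s_{k+1},s'_{k+1})$ with $k\ge0$, $s_j,s_j'\in\Sigma$, all $m_{s_js_j'}$ finite, where for $0\le j\le k$: $s'_{j+1}=s'_j$ if $m_{s_js'_j}$ is even, $s'_{j+1}=s_j$ if it is odd; $s_0>s'_0$, $s_j<s'_j$ for $1\le j\le k+1$; $\{s_j,s'_j\}\ne\{s_{j+1},s'_{j+1}\}$ for $0\le j\le k$. Notation. $f\in(3')$ has data $s_j,s'_j$ $(0\le j\le k+1)$; $u_j=(m-1)(s_j,s'_j)$,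 $x_j$ is the last letter of $u_j$, $y_j$ the last letter of $m(s_j,s_j')$ (so $y_j=s'_{j+1}$ for $j\le k$). Thus $f=u_0\cdots u_{k+1}y_{k+1}-s'_0u_0\cdots u_{k+1}$ and $\bar f=u_0\cdots u_{k+1}y_{k+1}$. $g\in(3')$ has data $p_j,p'_j$ $(0\le j\le q+1)$, $v_j=(m-1)(p_j,p'_j)$, $z_j$ the last letter of $m(p_j,p'_j)$, $g=v_0\cdots v_{q+1}z_{q+1}-p'_0v_0\cdots v_{q+1}$, $\bar g=v_0\cdots v_{q+1}z_{q+1}$. By convention $u_0\cdots u_{i-1}=1$ if $i=0$ and $u_{l+2}\cdots u_{k+1}=1$ if $l=k$. If $\bar f=a\bar gb$, the inclusion composition is $(f,g)_{\bar f}=f-agb$. $h\equiv h'$ modulo $(S,\bar f)$ means $h-h'=\sum\alpha_ra_rs_rb_r$ with $\alpha_r\in F$, $s_r\in S$, $a_r,b_r\in\Sigma^*$, $a_r\overline{s_r}b_r<\bar f$. *)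

(* Defs.v *)
From HB Require Import structures.
From mathcomp Require Import all_boot all_order all_algebra.
From mathcomp Require Import finmap.
From mathcomp Require Import monalg.

Set Implicit Arguments.
Unset Strict Implicit.
Unset Printing Implicit Defensive.

Import Order.TTheory GRing.Theory.
Local Open Scope ring_scope.

(* Letters sigma_1 < ... < sigma_n are the elements of 'I_n.  Words are handled
   as sequences; [mon] below sends them to the monomials of the free algebra. *)
Notation word n := (seq 'I_n).
Notation free_alg F n := {malg F[{fmonom 'I_n}]}.

Definition mon (F : fieldType) (n : nat) (w : word n) : free_alg F n :=
  << FMonom w >>.

Definition deglex_lt (n : nat) (u v : word n) : bool :=
  (size u < size v)%N
  || (size u == size v) && ((u : seqlexi 'I_n) < (v : seqlexi 'I_n))%O.

Definition deglex_max (n : nat) (u v : word n) : word n :=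
  if deglex_lt u v then v else u.

(* The empty word is the least word, and is the (junk) value at 0. *)
Definition lead (F : fieldType) (n : nat) (f : free_alg F n) : word n :=
  \big[@deglex_max n/[::]]_(w <- msupp f) (w : word n).

(* Here None stands for infinity. *)
Record coxeter_matrix (n : nat) := CoxeterMatrix {
  cox_entry :> 'I_n -> 'I_n -> option nat;
  cox_sym : forall a b, cox_entry a b = cox_entry b a;
  cox_diag : forall a, cox_entry a a = Some 1%N;
  cox_offdiag : forall a b m, a != b -> cox_entry a b = Some m -> (2 <= m)%N
}.

(* The integer m_{ab}; only meaningful when m_{ab} is finite. *)
Definition cox_m (n : nat) (M : coxeter_matrix n) (a b : 'I_n) : nat :=
  odflt 0%N (M a b).

(* The word (m - t)(a, b) = abab... of length m_{ab} - t. *)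
Definition alt (n : nat) (M : coxeter_matrix n) (t : nat) (a b : 'I_n) :
    word n :=
  mkseq (fun r => if odd r then b else a) (cox_m M a b - t).

(* The conditions on the data s_j, s'_j (0 <= j <= k + 1) of an element of (3');
   the values of s and s' beyond k + 1 are irrelevant. *)
Record data3 (n : nat) (M : coxeter_matrix n) (k : nat)
    (s s' : nat -> 'I_n) : Prop := Data3 {
  data3_finite : forall j, (j <= k.+1)%N -> M (s j) (s' j) <> None;
  data3_step : forall j, (j <= k)%N ->
    s' j.+1 = if odd (cox_m M (s j) (s' j)) then s j else s' j;
  data3_gt0 : (s' 0%N < s 0%N)%N;
  data3_lt : forall j, (1 <= j <= k.+1)%N -> (s j < s' j)%N;
  data3_neq : forall j, (j <= k)%N ->
    [set s j; s' j] <> [set s j.+1; s' j.+1]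
}.

Definition blk (n : nat) (M : coxeter_matrix n) (s s' : nat -> 'I_n) (j : nat) :
    word n :=
  alt M 1 (s j) (s' j).

(* The word u_a u_{a+1} ... u_{b-1}, empty if b <= a. *)
Definition wprod (n : nat) (u : nat -> word n) (a b : nat) : word n :=
  \big[cat/[::]]_(a <= j < b) u j.

Definition rel3 (F : fieldType) (n : nat) (M : coxeter_matrix n) (k : nat)
    (s s' : nat -> 'I_n) : free_alg F n :=
  mon F (wprod (blk M s s') 0 k.+1 ++ alt M 0 (s k.+1) (s' k.+1))
  - mon F (alt M 0 (s' 0%N) (s 0%N) ++ wprod (blk M s s') 1 k.+2).

Inductive coxS (F : fieldType) (n : nat) (M : coxeter_matrix n) :
    free_alg F n -> Prop :=
| CoxS1 (a : 'I_n) : coxS M (mon F [:: a; a] - 1)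
| CoxS2 (a b : 'I_n) of (b < a)%N & M a b <> None :
    coxS M (mon F (alt M 0 a b) - mon F (alt M 0 b a))
| CoxS3 (k : nat) (s s' : nat -> 'I_n) of data3 M k s s' :
    coxS M (rel3 F M k s s').

(* h = h' modulo (S, w).  A term alpha a s b is encoded as (alpha, a, s, b). *)
Definition congr_mod (F : fieldType) (n : nat) (S : free_alg F n -> Prop)
    (w : word n) (h h' : free_alg F n) : Prop :=
  exists r : seq (F * word n * free_alg F n * word n),
    (forall c a x b, (c, a, x, b) \in r ->
       S x /\ deglex_lt (a ++ lead x ++ b) w) /\
    h - h' = \sum_(t <- r) let: (c, a, x, b) := t in
                           c *: (mon F a * x * mon F b).

Definition incl_comp (F : fieldType) (n : nat) (f g : free_alg F n)
    (a b : word n) : free_alg F n :=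
  f - mon F a * g * mon F b.

(* Main.v *)
Require Import Defs.
From mathcomp Require Import all_boot all_order all_algebra.
From mathcomp Require Import finmap.
From mathcomp Require Import monalg.

Set Implicit Arguments.
Unset Strict Implicit.
Unset Printing Implicit Defensive.

Import Order.TTheory GRing.Theory.
Local Open Scope ring_scope.

(** Put y = s'_{i+1}, which is also the last letter of m(s_i, s'_i), and let x
be the last letter of u_i.  Cancelling the prefix and the suffix in the
hypothesis on the occurrence leaves

   v_0 v_1 ... v_{q+1} z_{q+1} = y x u_{i+1} ... u_l s_{l+1},

where x and y do not commute (m_{xy} = m_{s_i s'_i} >= 3), and neither do
s_{l+1} and s'_{l+1} (since |u_{l+1}| > 1).  This equation is very rigid.

- |v_0| = 1.  A longer v_0 reads y x and then y, while the third letter is s_{i+1} < y, or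
  stops after y x with p'_1 = y = s'_{i+1}.  In the second case both sides go
  on with the same primed letter; then they agree block by block,
  because the first letter of a block, together with its primed letter,
  determines the block and the next primed letter.  But the left side ends
  with the last letter of a full alternating word and the right side with the
  first letter of a block, and these differ ([sync_mismatch]).

- So p_0 = y commutes with p'_0 = p'_1, and p'_1 < y.  The primed letters
  p'_1 >= p'_2 >= ... bound all later letters of the left side, so y does not
  occur in u_{i+1}, ..., u_l.  A primed letter absent from its block forces a
  block of length 1, which passes the same primed letter on
  ([exit_persists]).  Hence every u_j with i < j <= l is the letter s_j, which
  commutes with y, and s'_{l+1} = y ([inner_blocks_single]).

- The last letter z_{q+1} = s_{l+1} does not commute with y, whereas p'_1 and
  all first letters of v_2, ..., v_{q+1} do.  An exit letter is always one of
  its block's two letters, so the letter x = p_1 must have become the primed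
  letter: m_{p_1 p'_1} is odd.  A second x inside v_1, or an x inside a later
  block, would be one of the s_j with i < j <= l; these commute with y and x
  does not.  This gives |v_1| = 2, p'_r = x and |v_r| = 1 for r >= 2, and
  s_{l+1} = x ([inner_blocks_rigid]).

Therefore alternative (ii) always holds, and alternative (i) never occurs.
The words of (ii) are then literally those of the composition, so the
congruence is witnessed by the empty combination. *)

(** * Monomials and leading words *)

Lemma monM (F : fieldType) (n : nat) (w1 w2 : word n) :
  mon F w1 * mon F w2 = mon F (w1 ++ w2).
Proof.
rewrite /mon malgM_def fgmulUU mulr1.
by congr << _ >>; rewrite /mmul /= /fmmul fmE.
Qed.

(** The two leading monomials cancel, which leaves the other monomial of each
binomial. *)
Lemma incl_comp_sub (F : fieldType) (n : nat) (w1 w2 v1 v2 a b : word n) :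
  w1 = a ++ v1 ++ b ->
  incl_comp (mon F w1 - mon F w2) (mon F v1 - mon F v2) a b
    = mon F (a ++ v2 ++ b) - mon F w2.
Proof.
move=> ->; rewrite /incl_comp mulrBr mulrBl !monM -!catA.
have cancel (x1 x2 y2 : free_alg F n) : x1 - x2 - (x1 - y2) = y2 - x2.
  by rewrite opprB [LHS]addrC addrA subrK.
exact: cancel.
Qed.

Lemma deglex_lt_asym (n : nat) (w1 w2 : word n) :
  deglex_lt w1 w2 -> ~~ deglex_lt w2 w1.
Proof.
rewrite /deglex_lt; case: ltngtP => //= _ w12.
by apply/negP => /(lt_trans w12); rewrite ltxx.
Qed.

Lemma deglex_lt_head (n : nat) (a b : 'I_n) (w1 w2 : word n) :
  size w1 = size w2 -> (a < b)%N -> deglex_lt (a :: w1) (b :: w2).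
Proof.
move=> eqw ab; rewrite /deglex_lt /= eqw eqxx ltnn /=.
rewrite ltxi_cons; apply/andP; split; first by rewrite leEord ltnW.
by rewrite leEord leqNgt ab.
Qed.

(** The enumeration order of the support is unspecified, so both orders of the
two monomials are considered. *)
Lemma lead_sub (F : fieldType) (n : nat) (w1 w2 : word n) :
  deglex_lt w2 w1 -> lead (mon F w1 - mon F w2) = w1.
Proof.
move=> lt21; have nlt12 := deglex_lt_asym lt21.
have neq : FMonom w1 != FMonom w2.
  by apply/eqP => -[e]; move: lt21 nlt12; rewrite e => ->.
have maxn0 (w : word n) : deglex_max w [::] = w.
  by rewrite /deglex_max; case: w.
rewrite /lead; set D := msupp _.
have defD : D =i [:: FMonom w1; FMonom w2].
  move=> m; rewrite !inE -mcoeff_neq0 mcoeffB !mcoeffU -!(eq_sym m).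
  have [->|_] := eqVneq m (FMonom w1).
    by rewrite (negPf neq) mulr1n mulr0n subr0 oner_neq0.
  by case: (m == _); rewrite ?mulr1n ?mulr0n sub0r ?oppr_eq0 ?oner_neq0 ?eqxx.
have pD : perm_eq D [:: FMonom w1; FMonom w2].
  by apply: uniq_perm; rewrite //= ?fset_uniq // inE neq.
have := perm_mem pD; have := perm_size pD.
case: (D : seq _) (fset_uniq D) => [|m1 [|m2 []]] //= /andP[]; rewrite inE => m12 _ _ mD.
have := mD m1; have := mD m2; rewrite !inE !eqxx ?orbT /=.
rewrite !big_cons big_nil maxn0.
move=> /esym/orP[]/eqP e2 /esym/orP[]/eqP e1; move: m12; rewrite e1 e2 ?eqxx //= => _.
  by rewrite /deglex_max lt21.
by rewrite /deglex_max (negPf nlt12).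
Qed.

(** * Alternating words and products of blocks *)

Definition altword (T : Type) (r : nat) (a b : T) : seq T :=
  mkseq (fun j => if odd j then b else a) r.

Lemma altE (n : nat) (M : coxeter_matrix n) t a b :
  alt M t a b = altword (cox_m M a b - t) a b.
Proof. by []. Qed.

Lemma altwordS (T : Type) r (a b : T) : altword r.+1 a b = a :: altword r b a.
Proof.
rewrite /altword /mkseq /= -[1%N]addn0 iotaDl -map_comp; congr cons.
by apply: eq_map => j /=; case: (odd j).
Qed.

Lemma altword_rcons (T : Type) r (a b : T) :
  altword r.+1 a b = rcons (altword r a b) (if odd r then b else a).
Proof. by rewrite /altword /mkseq -addn1 iotaD map_cat cats1. Qed.

Lemma size_altword (T : Type) r (a b : T) : size (altword r a b) = r.
Proof. exact: size_mkseq. Qed.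

Lemma mem_altword (T : eqType) r (a b c : T) :
  c \in altword r a b -> c = a \/ c = b.
Proof. by case/mapP => j _ ->; case: (odd j); [right|left]. Qed.

Lemma cox_m_sym (n : nat) (M : coxeter_matrix n) a b : cox_m M a b = cox_m M b a.
Proof. by rewrite /cox_m cox_sym. Qed.

Lemma wprod_recl (n : nat) (u : nat -> word n) a b :
  (a < b)%N -> wprod u a b = u a ++ wprod u a.+1 b.
Proof. by move=> ab; rewrite /wprod big_ltn. Qed.

Lemma wprod_nil (n : nat) (u : nat -> word n) a : wprod u a a = [::].
Proof. by rewrite /wprod big_geq. Qed.

Lemma wprod_split (n : nat) (u : nat -> word n) a b c :
  (a <= b)%N -> (b <= c)%N -> wprod u a c = wprod u a b ++ wprod u b c.
Proof. by move=> ab bc; rewrite /wprod -big_cat_nat. Qed.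

Lemma mem_wprodP (n : nat) (u : nat -> word n) a b c :
  reflect (exists2 j, (a <= j < b)%N & c \in u j) (c \in wprod u a b).
Proof.
have -> : wprod u a b = flatten [seq u j | j <- index_iota a b].
  rewrite /wprod; elim: (index_iota a b) => [|j r IHr]; first by rewrite big_nil.
  by rewrite big_cons IHr.
apply: (iffP flatten_mapP) => -[j jab cu]; exists j => //.
  by rewrite mem_index_iota in jab.
by rewrite mem_index_iota.
Qed.

Lemma cat_injl (T : Type) (w : seq T) : injective (cat w).
Proof. by elim: w => [//|c w IHw] w1 w2 [/IHw]. Qed.

Lemma cat_injr (T : Type) (w : seq T) : injective (cat^~ w).
Proof.
move=> w1 w2 /(congr1 rev) /=; rewrite !rev_cat => /cat_injl.
exact: (can_inj revK).
Qed.

(** * The data of a relation *)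

(** The last letter of m(s_j, s'_j), written y_j or z_j informally; for j <= k
it is also s'_{j+1}. *)
Definition exit_letter (n : nat) (M : coxeter_matrix n) (s s' : nat -> 'I_n)
    (j : nat) : 'I_n :=
  if odd (cox_m M (s j) (s' j)) then s j else s' j.

Lemma data3_exit (n : nat) (M : coxeter_matrix n) k s s' j :
  data3 M k s s' -> (j <= k)%N -> s' j.+1 = exit_letter M s s' j.
Proof. by move=> D /(data3_step D). Qed.

Lemma data3_letters_neq (n : nat) (M : coxeter_matrix n) k s s' j :
  data3 M k s s' -> (j <= k.+1)%N -> s j != s' j.
Proof.
move=> D jk; apply/eqP => e; case: j jk e => [|j] jk e.
  by have := data3_gt0 D; rewrite e ltnn.
by have := @data3_lt _ _ _ _ _ D j.+1 jk; rewrite e ltnn.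
Qed.

Lemma data3_m_ge2 (n : nat) (M : coxeter_matrix n) k s s' j :
  data3 M k s s' -> (j <= k.+1)%N -> (2 <= cox_m M (s j) (s' j))%N.
Proof.
move=> D jk; have := data3_finite D jk; rewrite /cox_m.
case e: (M (s j) (s' j)) => [m|//] _ /=.
exact: cox_offdiag (data3_letters_neq D jk) e.
Qed.

Lemma blk_cons (n : nat) (M : coxeter_matrix n) k s s' j :
  data3 M k s s' -> (j <= k.+1)%N ->
  blk M s s' j = s j :: alt M 2 (s' j) (s j).
Proof.
move=> D jk; have := data3_m_ge2 D jk.
rewrite /blk !altE (cox_m_sym _ (s' j)).
by case: (cox_m M _ _) => [|[|m]] // _; rewrite !subSS !subn0 altwordS.
Qed.

Lemma size_blk (n : nat) (M : coxeter_matrix n) (s s' : nat -> 'I_n) j :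
  size (blk M s s' j) = (cox_m M (s j) (s' j)).-1.
Proof. by rewrite size_altword subn1. Qed.

Lemma blk1 (n : nat) (M : coxeter_matrix n) (s s' : nat -> 'I_n) j :
  cox_m M (s j) (s' j) = 2%N -> blk M s s' j = [:: s j].
Proof. by rewrite /blk altE => ->. Qed.

(** The larger of the two words of the relation: m(s_{k+1}, s'_{k+1}) is split
as u_{k+1} y_{k+1} so that all blocks are treated alike. *)
Definition lead_word (n : nat) (M : coxeter_matrix n) k (s s' : nat -> 'I_n) :
    word n :=
  wprod (blk M s s') 0 k.+2 ++ [:: exit_letter M s s' k.+1].

Lemma alt0_rcons (n : nat) (M : coxeter_matrix n) k s s' j :
  data3 M k s s' -> (j <= k.+1)%N ->
  alt M 0 (s j) (s' j) = rcons (blk M s s' j) (exit_letter M s s' j).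
Proof.
move=> D jk; have := data3_m_ge2 D jk; rewrite /exit_letter /blk !altE.
case: (cox_m M _ _) => [|m] // _.
by rewrite !subSS !subn0 altword_rcons /=; case: (odd m).
Qed.

Lemma rel3E (F : fieldType) (n : nat) (M : coxeter_matrix n) k s s' :
  data3 M k s s' ->
  rel3 F M k s s' = mon F (lead_word M k s s')
                    - mon F (s' 0%N :: wprod (blk M s s') 0 k.+2).
Proof.
move=> D; rewrite /rel3.
have -> : wprod (blk M s s') 0 k.+1 ++ alt M 0 (s k.+1) (s' k.+1)
          = lead_word M k s s'.
  rewrite (alt0_rcons D) // -cats1 catA /lead_word; congr (_ ++ _).
  by rewrite (@wprod_split _ _ 0 k.+1 k.+2) // (@wprod_recl _ _ k.+1) // wprod_nil cats0.
have -> // : alt M 0 (s' 0%N) (s 0%N) ++ wprod (blk M s s') 1 k.+2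
          = s' 0%N :: wprod (blk M s s') 0 k.+2.
rewrite (@wprod_recl _ _ 0) // -cat_cons; congr (_ ++ _).
rewrite /blk !altE cox_m_sym; have := data3_m_ge2 D (leq0n _).
by case: (cox_m M _ _) => [|m] // _; rewrite subn0 subn1 altwordS.
Qed.

(** Both words of the relation have the same length, and the first letters
s_0 > s'_0 decide the comparison. *)
Lemma lead_rel3 (F : fieldType) (n : nat) (M : coxeter_matrix n) k s s' :
  data3 M k s s' -> lead (rel3 F M k s s') = lead_word M k s s'.
Proof.
move=> D; rewrite (rel3E _ D); apply: lead_sub.
rewrite /lead_word (@wprod_recl _ _ 0) // (blk_cons D) //=.
by apply: deglex_lt_head (data3_gt0 D); rewrite cats1 size_rcons.
Qed.

(** * Rigidity of the primed letters *)

(** Two chains of blocks with the same primed letter and the same remaining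
word have equal blocks, because the first letter and the primed letter
determine the block and the next primed letter.  They cannot end together: the
left word ends with the first letter s_{l+1} of a block, the right word with an
exit letter, and at that point the exit letter is s'_{l+1}. *)
Lemma sync_mismatch (n : nat) (M : coxeter_matrix n) k s s' q p p' l j t :
  data3 M k s s' -> data3 M q p p' ->
  (l <= k)%N -> (j <= l.+1)%N -> (t <= q.+1)%N -> s' j = p' t ->
  wprod (blk M s s') j l.+1 ++ [:: s l.+1]
    <> wprod (blk M p p') t q.+2 ++ [:: exit_letter M p p' q.+1].
Proof.
move=> Df Dg lk jl tq est.
move ed: (l.+1 - j)%N => d; elim: d => [|d IHd] in j t ed jl tq est *.
  (* The left word has one letter, the right word at least two. *)
  have -> : j = l.+1 by apply/eqP; rewrite eqn_leq jl -subn_eq0 ed.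
  rewrite wprod_nil wprod_recl // (blk_cons Dg) //= => -[_ /(congr1 size)].
  by rewrite !size_cat addn1.
have jltl : (j < l.+1)%N by rewrite -subn_gt0 ed.
have jk : (j <= k)%N by apply: leq_trans lk.
rewrite wprod_recl // [in RHS]wprod_recl // => e.
have est1 : s j = p t.
  by move: e; rewrite (blk_cons Df) ?(leqW jk) // (blk_cons Dg) // => -[].
have eblk : blk M s s' j = blk M p p' t by rewrite /blk est est1.
have eexit : s' j.+1 = exit_letter M p p' t.
  by rewrite (data3_exit Df) // /exit_letter est est1.
move: e; rewrite eblk -!catA => /(congr1 (drop (size (blk M p p' t)))).
rewrite !drop_size_cat //; move: tq; rewrite leq_eqVlt => /predU1P[et|tq].
  (* The right word is down to its exit letter, which is now s'_{j+1}; the left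
     word goes on with s_{j+1}, whether j + 1 <= l or j = l. *)
  rewrite et wprod_nil /=.
  have hd : exists w, wprod (blk M s s') j.+1 l.+1 ++ [:: s l.+1] = s j.+1 :: w.
    move: jltl; rewrite ltnS leq_eqVlt => /predU1P[->|jltl].
      by rewrite wprod_nil; exists [::].
    rewrite wprod_recl // (blk_cons Df) /=; first by eexists.
    by rewrite ltnS.
  case: hd => w -> [e _]; have := data3_letters_neq Df (_ : (j.+1 <= k.+1)%N).
  by rewrite e eexit et eqxx => /(_ jk).
apply: IHd => //; first by rewrite subnS ed.
by rewrite eexit -(data3_exit Dg).
Qed.

(** A block of length at least 2 contains its primed letter.  So as long as that
letter is avoided, the blocks are single letters with m = 2, and since 2 is
even the primed letter is passed on unchanged. *)
Lemma exit_persists (n : nat) (M : coxeter_matrix n) k s s' j0 j :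
  data3 M k s s' -> (j0 <= j <= k.+1)%N ->
  (forall r, (j0 <= r <= j)%N -> s' j0 \notin blk M s s' r) ->
  s' j = s' j0 /\ cox_m M (s j) (s' j) = 2%N.
Proof.
move=> D; elim: j => [|j IHj] /andP[jj jk] notin.
all: have step r : (j0 <= r <= k.+1)%N -> s' j0 \notin blk M s s' r ->
       s' r = s' j0 -> cox_m M (s r) (s' r) = 2%N.
1,3: move=> /andP[_ rk] nin er; move: nin; rewrite -er (blk_cons D) // altE;
  have := data3_m_ge2 D rk; rewrite cox_m_sym;
  case: (cox_m M _ _) => [|[|[|m]]] // _;
  by rewrite !subSS subn0 altwordS !inE eqxx orbT.
  have e0 : j0 = 0%N by apply/eqP; rewrite -leqn0.
  by rewrite e0 in notin step *; split=> //; apply: step => //; apply: notin.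
move: (jj); rewrite leq_eqVlt => /predU1P[e0|jlt].
  rewrite e0 in notin step *; split=> //; apply: step; rewrite ?leqnn //.
  by apply: notin; rewrite leqnn.
have [||ej mj] := IHj.
- by rewrite -ltnS jlt ltnW.
- by move=> r /andP[r0 rj]; apply: notin; rewrite r0 leqW.
have ej1 : s' j.+1 = s' j0.
  by rewrite (data3_exit D) // /exit_letter mj ej.
by split=> //; apply: step; rewrite ?ej1 ?jj // notin ?jj ?leqnn.
Qed.

Lemma exit_le (n : nat) (M : coxeter_matrix n) k s s' j :
  data3 M k s s' -> (1 <= j <= k.+1)%N -> (exit_letter M s s' j <= s' j)%N.
Proof.
move=> D jk; rewrite /exit_letter; case: ifP => // _.
exact/ltnW/(data3_lt D).
Qed.

(** After the first block, s_j < s'_j, so the primed letters decrease. *)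
Lemma prime_letter_le (n : nat) (M : coxeter_matrix n) k s s' j :
  data3 M k s s' -> (1 <= j <= k.+1)%N -> (s' j <= s' 1)%N.
Proof.
move=> D; elim: j => [//|[|j] IHj] // jk.
have jk1 : (1 <= j.+1 <= k.+1)%N by case/andP: jk => _ /ltnW ->.
by rewrite (data3_exit D) //; apply: leq_trans (exit_le D jk1) (IHj jk1).
Qed.

Lemma blk_letter_le (n : nat) (M : coxeter_matrix n) k s s' j c :
  data3 M k s s' -> (1 <= j <= k.+1)%N -> c \in blk M s s' j -> (c <= s' 1)%N.
Proof.
move=> D jk /mem_altword cE; apply: leq_trans (prime_letter_le D jk).
by case: cE => ->; rewrite // ltnW // (data3_lt D).
Qed.

Lemma wprod_single (n : nat) (M : coxeter_matrix n) (s s' : nat -> 'I_n) a b :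
  (forall j, (a <= j < b)%N -> cox_m M (s j) (s' j) = 2%N) ->
  wprod (blk M s s') a b = map s (index_iota a b).
Proof.
move=> m2; rewrite /wprod big_nat (eq_bigr (fun j => [:: s j])).
  by rewrite -big_nat; elim: (index_iota a b) => [|r w IHw]; rewrite ?big_nil // big_cons IHw.
by move=> j /m2 /blk1.
Qed.

Lemma last_blk (n : nat) (M : coxeter_matrix n) k s s' j :
  data3 M k s s' -> (j <= k.+1)%N ->
  last (s j) (blk M s s' j) = if odd (cox_m M (s j) (s' j)) then s' j else s j.
Proof.
move=> D jk; have := data3_m_ge2 D jk; rewrite /blk altE.
case: (cox_m M _ _) => [|[|m]] // _.
by rewrite subn1 altword_rcons last_rcons /= negbK.
Qed.

Lemma blk_split2 (n : nat) (M : coxeter_matrix n) k s s' j :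
  data3 M k s s' -> (j <= k.+1)%N -> (3 <= cox_m M (s j) (s' j))%N ->
  blk M s s' j = alt M 3 (s j) (s' j)
                 ++ [:: exit_letter M s s' j; last (s j) (blk M s s' j)].
Proof.
move=> D jk; rewrite (last_blk D) // /exit_letter /blk !altE.
case: (cox_m M _ _) => [|[|[|m]]] // _.
rewrite !subSS !subn0 /= !altword_rcons -!cats1 -catA.
by rewrite /=; case: (odd m).
Qed.

(** * The word between the prefix and the suffix *)

Lemma inner_occurrence (n : nat) (M : coxeter_matrix n) k s s' i l w :
  data3 M k s s' -> (i < l)%N -> (l <= k)%N ->
  (3 <= cox_m M (s i) (s' i))%N ->
  lead_word M k s s'
    = (wprod (blk M s s') 0 i ++ alt M 3 (s i) (s' i)) ++ w
      ++ alt M 2 (s' l.+1) (s l.+1) ++ wprod (blk M s s') l.+2 k.+2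
      ++ [:: exit_letter M s s' k.+1] ->
  w = [:: s' i.+1, last (s i) (blk M s s' i)
       & wprod (blk M s s') i.+1 l.+1 ++ [:: s l.+1]].
Proof.
move=> D il lk m3; set xi := last _ _.
have ik : (i < k)%N := leq_trans il lk.
have lk1 : (l < k.+1)%N := lk.
rewrite /lead_word (@wprod_split _ _ 0 i) ?(leqW (leqW (ltnW ik))) //.
rewrite (@wprod_recl _ _ i) ?(leqW (leqW ik)) //.
rewrite [blk M s s' i](blk_split2 D) ?(leqW (ltnW ik)) // -/xi.
rewrite (@wprod_split _ _ i.+1 l.+1) ?(leqW lk1) ?(leqW il) //.
rewrite (@wprod_recl _ _ l.+1) // (blk_cons D) //.
rewrite (data3_exit D (ltnW ik)) -cat1s -!catA => /cat_injl/cat_injl.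
by rewrite -[_ :: alt _ _ _ _]cat1s !catA => /cat_injr/cat_injr/cat_injr <-.
Qed.

(** A first block longer than one letter starts with y x.  If it stops there,
its m is 3 and its exit letter is y, so that the two chains are synchronised
from there on; if it does not, its third letter is y, instead of s_{i+1}. *)
Lemma first_block_single (n : nat) (M : coxeter_matrix n) k s s' q p p' i l x :
  data3 M k s s' -> data3 M q p p' -> (i < l)%N -> (l <= k)%N ->
  lead_word M q p p' = [:: s' i.+1, x
                        & wprod (blk M s s') i.+1 l.+1 ++ [:: s l.+1]] ->
  cox_m M (p 0%N) (p' 0%N) = 2%N.
Proof.
move=> Df Dg il lk e.
have : (2 <= cox_m M (p 0%N) (p' 0%N))%N by apply: (data3_m_ge2 Dg).
rewrite leq_eqVlt => /predU1P[<- //|m3].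
have i1k : (i.+1 <= k.+1)%N by apply: leqW (leq_trans il lk).
move: e; rewrite /lead_word wprod_recl // -catA.
have [m3E|m4] : cox_m M (p 0%N) (p' 0%N) = 3%N \/ (3 < cox_m M (p 0%N) (p' 0%N))%N.
  by move: m3; rewrite leq_eqVlt => /predU1P[<-|]; [left|right].
  rewrite {1}/blk altE m3E => -[e0 _] e.
  have est : s' i.+1 = p' 1%N by rewrite (data3_exit Dg) // /exit_letter m3E -e0.
  by case: (sync_mismatch Df Dg lk (leqW il : i.+1 <= l.+1)%N (ltn0Sn q) est (esym e)).
rewrite /blk {1}altE; case: (cox_m M _ _) m4 => [|[|[|[|m]]]] // _.
rewrite subn1 !altwordS => -[e0 _]; rewrite [wprod (blk M s s') _ _]wprod_recl ?ltnS //.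
rewrite (blk_cons Df) // => -[e1 _]; have := data3_letters_neq Df i1k.
by rewrite -e0 -e1 eqxx.
Qed.

(** Once the first block is the single letter y, the letters that follow are at
most p'_1 = p'_0 < y, so no block between the ends can contain y. *)
Lemma inner_blocks_single (n : nat) (M : coxeter_matrix n) k s s' q p p' i l x j :
  data3 M k s s' -> data3 M q p p' -> (l <= k)%N ->
  lead_word M q p p' = [:: s' i.+1, x
                        & wprod (blk M s s') i.+1 l.+1 ++ [:: s l.+1]] ->
  cox_m M (p 0%N) (p' 0%N) = 2%N ->
  (i < j <= l)%N -> s' j = s' i.+1 /\ cox_m M (s j) (s' j) = 2%N.
Proof.
move=> Df Dg lk e m0 /andP[ij jl].
move: e; rewrite /lead_word wprod_recl // (blk1 m0) /= => -[p0 e].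
apply: (exit_persists Df); first by rewrite ij leqW // (leq_trans jl).
move=> r /andP[ir rj]; apply/negP => yu.
have : s' i.+1 \in x :: wprod (blk M s s') i.+1 l.+1 ++ [:: s l.+1].
  rewrite inE mem_cat; apply/orP; right; apply/orP; left.
  by apply/mem_wprodP; exists r; rewrite // ir ltnS (leq_trans rj).
have p1 : p' 1%N = p' 0%N by rewrite (data3_exit Dg) // /exit_letter m0.
suff small c : c \in wprod (blk M p p') 1 q.+2 ++ [:: exit_letter M p p' q.+1] ->
    (c <= p' 1%N)%N.
  by rewrite -e => /small; rewrite -p0 p1 leqNgt (data3_gt0 Dg).
rewrite mem_cat inE => /orP[/mem_wprodP[t tq]|/eqP->]; first exact: (blk_letter_le Dg).
by apply: leq_trans (exit_le Dg _) (prime_letter_le Dg _); rewrite /= leqnn.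
Qed.

(** With an even first step the primed letter is carried over, and every later
exit letter is then either that letter or some p_r with r >= 2. *)
Lemma exit_commutes (n : nat) (M : coxeter_matrix n) q p p' y j :
  data3 M q p p' -> (1 <= j <= q.+1)%N ->
  cox_m M (p' 1%N) y = 2%N -> ~~ odd (cox_m M (p 1%N) (p' 1%N)) ->
  (forall r, (1 < r <= q.+1)%N -> cox_m M (p r) y = 2%N) ->
  cox_m M (exit_letter M p p' j) y = 2%N.
Proof.
move=> D jq c1 ev1 cr; elim: j jq => [//|[|j] IHj] jq.
  by rewrite /exit_letter (negPf ev1).
rewrite /exit_letter; case: ifP => _; first exact: cr.
by rewrite (data3_exit D) ?IHj //; case/andP: jq => _ /ltnW.
Qed.

(** The letter x is the only one before the last position that does not commute
with y.  As the last letter s_{l+1} does not commute with y either, x has to be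
carried there as a primed letter, and it may not be written on the way. *)
Lemma inner_blocks_rigid (n : nat) (M : coxeter_matrix n) k s s' q p p' i l x :
  data3 M k s s' -> data3 M q p p' -> (i < l)%N -> (l <= k)%N ->
  (3 <= cox_m M x (s' i.+1))%N -> (3 <= cox_m M (s l.+1) (s' l.+1))%N ->
  lead_word M q p p' = [:: s' i.+1, x
                        & wprod (blk M s s') i.+1 l.+1 ++ [:: s l.+1]] ->
  [/\ cox_m M (p 0%N) (p' 0%N) = 2%N, cox_m M (p 1%N) (p' 1%N) = 3%N,
      (forall r, (1 < r <= q.+1)%N -> cox_m M (p r) (p' r) = 2%N) &
  [/\ p' 0%N = s i.+1, s l.+1 = x, s' l.+1 = s' i.+1 &
      forall j, (i < j <= l)%N -> cox_m M (s j) (s' j) = 2%N]].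
Proof.
move=> Df Dg il lk mxy ml e.
have m0 := first_block_single Df Dg il lk e.
have single j := @inner_blocks_single _ _ _ _ _ _ _ _ _ _ _ j Df Dg lk e m0.
set y := s' i.+1 in mxy e single *.
have s'l : s' l.+1 = y.
  have [|<- ml2] := single l; rewrite ?il ?leqnn //.
  by rewrite (data3_exit Df) // /exit_letter ml2.
have p1 : p' 1%N = p' 0%N by rewrite (data3_exit Dg) // /exit_letter m0.
(* C is the part of the word between x and the last letter. *)
pose C := map s (index_iota i.+1 l.+1).
have commC c : c \in C -> cox_m M c y = 2%N.
  by case/mapP => j; rewrite mem_index_iota ltnS => /single[<- ?] ->.
have EC : wprod (blk M s s') i.+1 l.+1 = C.
  by apply: wprod_single => j; rewrite ltnS => /single[].
move: e; rewrite EC /lead_word wprod_recl // (blk1 m0) /= => -[p0 /eqP].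
rewrite -cat_cons !cats1 eqseq_rcons => /andP[/eqP e /eqP ez].
move: e; rewrite wprod_recl // (blk_cons Dg) //= => -[px e].
have commr r c : (1 < r <= q.+1)%N -> c \in blk M p p' r -> cox_m M c y = 2%N.
  move=> rq cr; apply: commC; rewrite -e mem_cat; apply/orP; right.
  by apply/mem_wprodP; exists r; rewrite // ltnS.
(* Otherwise the last letter would commute with y. *)
have odd1 : odd (cox_m M (p 1%N) (p' 1%N)).
  apply/negPn/negP => ev1; move: ml; rewrite s'l -ez (exit_commutes Dg) //.
  - by rewrite leqnn.
  - by rewrite p1 -p0 cox_m_sym.
  - by move=> r rq; apply: (commr r _ rq); rewrite (blk_cons Dg) ?inE ?eqxx //; case/andP: rq.
have notinC : x \notin C by apply/negP => /commC e2; rewrite e2 in mxy.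
(* An odd value of at least 5 would put a second x into v_1, hence into C. *)
have m1 : cox_m M (p 1%N) (p' 1%N) = 3%N.
  have := data3_m_ge2 Dg (isT : (1 <= q.+1)%N); move: e odd1 notinC.
  rewrite altE (cox_m_sym _ (p' _)) -px.
  case: (cox_m M _ _) => [|[|[|[|m]]]] // <- _ + _.
  by rewrite !subSS subn0 !altwordS !inE eqxx orbT.
have ex1 : exit_letter M p p' 1 = x by rewrite /exit_letter m1.
(* From v_2 on, the primed letter x does not occur in the blocks. *)
have m2 r : (1 < r <= q.+1)%N -> p' r = x /\ cox_m M (p r) (p' r) = 2%N.
  case/andP => r1 rq; have p2 : p' 2%N = x.
    by rewrite (data3_exit Dg) // -ltnS (leq_trans r1).
  rewrite -p2; apply: (exit_persists Dg); first by rewrite r1.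
  move=> t /andP[t1 tr]; apply: contra notinC => xt; rewrite -p2 -e mem_cat.
  by apply/orP; right; apply/mem_wprodP; exists t; rewrite // t1 ltnS (leq_trans tr).
split=> //; first by move=> r /m2[].
split=> //; last by move=> j /single[].
  move: e; rewrite /C /index_iota subSS altE cox_m_sym m1 altwordS p1.
  by rewrite -(subnSK il) => -[].
rewrite -ez; case: (q) m2 => [//|q1] m2.
by rewrite /exit_letter; have [|-> ->] := m2 q1.+2; rewrite ?leqnn.
Qed.

Theorem theorem3p15 (F : fieldType) (n : nat) (M : coxeter_matrix n)
    (k : nat) (s s' : nat -> 'I_n) (q : nat) (p p' : nat -> 'I_n) (i l : nat) :
  data3 M k s s' ->
  data3 M q p p' ->
  let f := rel3 F M k s s' in
  let g := rel3 F M q p p' in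
  let u := blk M s s' in
  let v := blk M p p' in
  let x := fun j => last (s j) (u j) in
  let y := fun j => last (s j) (alt M 0 (s j) (s' j)) in
  let a := wprod u 0 i ++ alt M 3 (s i) (s' i) in
  let b := alt M 2 (s' l.+1) (s l.+1) ++ wprod u l.+2 k.+2 ++ [:: y k.+1] in
  lead f <> lead g ->
  (i < l)%N -> (l <= k)%N ->
  lead f = a ++ lead g ++ b ->
  (3 <= cox_m M (s i) (s' i))%N ->
  a <> [::] ->
  (1 < size (u l.+1))%N ->
  [/\ size (v 0%N) = 1%N, size (v 1%N) = 1%N,
      (i = 0%N -> congr_mod (coxS M) (lead f) (incl_comp f g a b) 0)
    & ((0 < i)%N ->
       exists2 j, (i.+1 <= j <= l.+1)%N /\ s j = p' 0%N
         & congr_mod (coxS M) (lead f) (incl_comp f g a b)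
             (mon F (wprod u 0 i ++ [:: s i; s j] ++ alt M 2 (s' i) (s i)
                     ++ map s (index_iota i.+1 l.+1)
                     ++ wprod u l.+2 k.+2 ++ [:: y k.+1])
              - mon F (s' 0%N :: wprod u 0 k.+2)))]
  \/
  [/\ size (v 0%N) = 1%N, size (v 1%N) = 2%N,
      (forall r, (1 < r <= q.+1)%N -> size (v r) = 1%N)
    & congr_mod (coxS M) (lead f) (incl_comp f g a b)
        (mon F (wprod u 0 i ++ alt M 3 (s i) (s' i)
                ++ [:: s i.+1; s' i.+1; x i] ++ map s (index_iota i.+1 l.+1)
                ++ alt M 2 (s' i.+1) (x i)
                ++ wprod u l.+2 k.+2 ++ [:: y k.+1])
         - mon F (s' 0%N :: wprod u 0 k.+2))].
Proof.
move=> Df Dg f g u v x y a b _ il lk occ m3 _ ul.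
have ik : (i <= k.+1)%N by apply: leqW (ltnW (leq_trans il lk)).
have yE : y k.+1 = exit_letter M s s' k.+1.
  by rewrite /y (alt0_rcons Df) // last_rcons.
have occ' : lead_word M q p p'
    = [:: s' i.+1, x i & wprod (blk M s s') i.+1 l.+1 ++ [:: s l.+1]].
  apply: (inner_occurrence Df il lk m3).
  by rewrite -(lead_rel3 F Df) -(lead_rel3 F Dg) -yE.
have mxy : (3 <= cox_m M (x i) (s' i.+1))%N.
  rewrite (data3_exit Df) ?(leq_trans (ltnW il)) // /x (last_blk Df) // /exit_letter.
  by case: ifP => _; rewrite // cox_m_sym.
have ml : (3 <= cox_m M (s l.+1) (s' l.+1))%N.
  by move: ul; rewrite /u size_blk; case: (cox_m M _ _).
have [m0 m1 mr [p0 sl s'l mj]] := inner_blocks_rigid Df Dg il lk mxy ml occ'.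
right; split; first by rewrite /v size_blk m0.
- by rewrite /v size_blk m1.
- by move=> r /mr mr2; rewrite /v size_blk mr2.
(* The two sides are the same element of the free algebra. *)
exists [::]; split=> //; rewrite big_nil; apply/eqP; rewrite subr_eq0; apply/eqP.
have EC : wprod u i.+1 l.+1 = map s (index_iota i.+1 l.+1).
  by apply: wprod_single => j; rewrite ltnS => /mj.
have gE : wprod v 0 q.+2 = [:: s' i.+1, x i & map s (index_iota i.+1 l.+1)].
  move/eqP: occ'; rewrite /lead_word -EC !cats1 -!rcons_cons eqseq_rcons.
  by case/andP => /eqP.
have occw : lead_word M k s s' = a ++ lead_word M q p p' ++ b.
  by rewrite -(lead_rel3 F Df) -(lead_rel3 F Dg).
rewrite /f (rel3E _ Df) /g (rel3E _ Dg) (incl_comp_sub F _ _ occw).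
by rewrite -/v gE p0 /a /b s'l sl yE -catA.
Qed.
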